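(* For every connected, simple, locally finite graph $G$, there is a subdivision $G'$ of $G$ such that $\zeta(G')=1$.
   Context: A graph is locally finite if every vertex has finite degree (the graph may be infinite). Subdividing an edge $uv$ means deleting $uv$ and adding a path from $u$ to $v$ whose internal vertices are new; a subdivision of $G$ is a graph obtained from $G$ by a sequence of such operations (possibly applied to infinitely many edges). The Localization game on a graph $G$ with $k$ cops: the robber moves first, occupying a vertex; in each later robber move the robber moves to a neighboring vertex or stays put. On each cop move, the cops choose vertices $u_1,\dots,u_k$ (arbitrary) and learn the distances $d_i$ from each $u_i$ to the robber's current vertex. The cops capture the robber if after finitely many rounds they can determine the robber's vertex uniquely; otherwise the robber wins. The robber is omniscient. The localization number $\zeta(G)$ is the smallest cardinal $k$ such that $k$ cops have a winning strategy. *)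

(* Defs.v *)
From mathcomp Require Import all_boot.
From mathcomp Require Import boolp classical_sets functions cardinality.

Set Implicit Arguments.
Unset Strict Implicit.
Unset Printing Implicit Defensive.

Local Open Scope classical_set_scope.
Local Open Scope card_scope.

(* Simple graphs on an arbitrary, possibly infinite, vertex type. *)
Record graph := Graph {
  vertex :> Type;
  adj : vertex -> vertex -> Prop;
  adj_sym : forall u v, adj u v -> adj v u;
  adj_irrefl : forall v, ~ adj v v }.

Definition locally_finite (G : graph) : Prop :=
  forall v : G, finite_set [set u | adj v u].

Fixpoint walk (G : graph) (n : nat) (u v : G) : Prop :=
  if n is m.+1 then exists2 w, adj u w & walk m w v else u = v.

(* The null graph is not considered connected. *)
Definition connected (G : graph) : Prop :=
  inhabited G /\ forall u v : G, exists n, walk n u v.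

(* [None] stands for the distance between two distinct components. *)
Definition dist (G : graph) (u v : G) : option nat :=
  if pselect (exists n, `[< walk n u v >]) is left uv
  then Some (ex_minn uv) else None.

(* [H] is obtained, up to isomorphism, from [G] by replacing simultaneously
   every edge uv by a path of length [len u v] >= 1 from u to v with new internal
   vertices (the edge is left untouched when the length is 1).  The branch
   vertices are given by [f], and the path by [p u v 0], ..., [p u v (len u v)];
   the two orientations of an edge describe the same path, traversed in opposite
   directions.  [len] and [p] are irrelevant on pairs that are not edges. *)
Record is_subdivision (G H : graph) (f : G -> H) (len : G -> G -> nat)
    (p : G -> G -> nat -> H) : Prop := IsSubdivision {
  subdiv_inj : injective f;
  subdiv_len : forall u v, adj u v -> 0 < len u v;
  subdiv_start : forall u v, adj u v -> p u v 0 = f u;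
  subdiv_end : forall u v, adj u v -> p u v (len u v) = f v;
  subdiv_len_sym : forall u v, adj u v -> len v u = len u v;
  subdiv_rev : forall u v i, adj u v -> i <= len u v ->
    p v u i = p u v (len u v - i);
  subdiv_new : forall u v i w, adj u v -> 0 < i < len u v -> p u v i <> f w;
  subdiv_disjoint : forall u v i u' v' j,
    adj u v -> 0 < i < len u v -> adj u' v' -> 0 < j < len u' v' ->
    p u v i = p u' v' j ->
    [/\ u' = u, v' = v & j = i] \/ [/\ u' = v, v' = u & j = len u v - i];
  subdiv_cover : forall x,
    (exists w, x = f w) \/
    (exists u v i, [/\ adj u v, 0 < i < len u v & x = p u v i]);
  subdiv_adj : forall x y, adj x y <->
    exists u v i, [/\ adj u v, i < len u v, x = p u v i & y = p u v i.+1] }.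

Definition subdivision (G H : graph) : Prop :=
  exists f len p, @is_subdivision G H f len p.

(* The robber's positions at the successive rounds of the game. *)
Definition robber_path (G : graph) (r : nat -> G) : Prop :=
  forall n, r n.+1 = r n \/ adj (r n) (r n.+1).

(* The cops are indexed by a type [K], whose cardinal is their number.  An
   answer is the family of distances they learn in one round; a strategy gives
   their next probes from the list of all earlier answers (oldest first). *)
Definition answer (K : Type) : Type := K -> option nat.

Definition strategy (G : graph) (K : Type) : Type :=
  seq (answer K) -> K -> G.

Fixpoint answers (G : graph) (K : Type) (s : strategy G K) (r : nat -> G)
    (n : nat) : seq (answer K) :=
  if n is m.+1 then
    let h := answers s r m in rcons h (fun k => dist (s h k) (r m))
  else [::].

(* The answers of rounds 0, ..., n determine the position at round n: it is
   shared by all the robber paths that would have produced these answers. *)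
Definition located (G : graph) (K : Type) (s : strategy G K) (r : nat -> G)
    (n : nat) : Prop :=
  forall r', robber_path r' -> answers s r' n.+1 = answers s r n.+1 ->
    r' n = r n.

(* As the robber is omniscient, a winning strategy has to locate him whichever
   path he follows.  The number of rounds may depend on that path. *)
Definition cops_win (G : graph) (K : Type) : Prop :=
  exists s : strategy G K,
    forall r, robber_path r -> exists n, located s r n.

(* The localization number of [G] is the cardinal of [K].  There is always at
   least one cop, so that a one-vertex graph has localization number 1; by
   [cops_win_void] below, this convention is immaterial for other graphs. *)
Definition localization_number_is (G : graph) (K : Type) : Prop :=
  [/\ inhabited K, cops_win G K &
      forall J : Type, inhabited J -> cops_win G J -> [set: K] #<= [set: J]].

Lemma cops_win_void (G : graph) (x y : G) : x <> y -> ~ cops_win G 'I_0.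
Proof.
move=> xy [s sP].
have stay z : robber_path (fun _ : nat => z : G) by move=> n; left.
have eqA (a b : answer 'I_0) : a = b by apply/funext => -[].
have eqh (r r' : nat -> G) n : answers s r n = answers s r' n.
  by elim: n => //= n ->; congr rcons; apply: eqA.
have [n /(_ _ (stay y))] := sP _ (stay x).
by move=> /(_ (eqh _ _ _)) /esym.
Qed.

(* Main.v *)
(* Give each edge uv the length max (w u) (w v). Whatever the weights w are,
   any detour from u to v is longer than the edge uv by at least min (w u)
   (w v). Let w x depend only on the level of x, its distance in G to a root
   v0, and grow so fast with it that edges are much longer than the number
   of rounds spent probing all the vertices, each followed by its
   neighbours, of the next few levels. A first probe at v0 gives, up to one,
   the level of the robber's edge. The cop then probes such a list, during
   which the robber hardly moves. If he is deep inside an edge, the probes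
   of its two ends locate him. If he is near a branch vertex x, consider the
   probes of x and of its neighbours: either he steps on x, which any of
   them reveals, or he stays on one edge xz, and the probe of z locates him. *)
Require Import Defs.
From mathcomp Require Import all_boot zify.
From mathcomp Require Import boolp classical_sets functions cardinality.

Set Implicit Arguments.
Unset Strict Implicit.
Unset Printing Implicit Defensive.

(** * Subdivisions with prescribed edge lengths *)

Lemma orientation_exists (T : Type) :
  exists o : T -> T -> bool, forall u v, u <> v -> o v u = ~~ o u v.
Proof.
pose g (u v : T) : {classic T} := @xget {classic T} u [set u; v]%classic.
exists (fun u v => `[< g u v = u >]) => u v uv.
(* [g] chooses from an unordered pair; the default of [xget] depends on the order, but the set is
   nonempty. *)
have gC : g v u = g u v.
  rewrite /g setUC /xget; case: pselect => // -[]; exists u.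
  by apply/asboolP; left.
rewrite gC; have : [set u; v]%classic (g u v) by apply: xgetI; left.
case=> /= ->; case: asboolP; case: asboolP => // *; congruence.
Qed.

Section SubdivisionExists.
Variables (G : graph) (len : G -> G -> nat).
Hypothesis len_gt0 : forall u v, adj u v -> 0 < len u v.
Hypothesis len_sym : forall u v, adj u v -> len v u = len u v.
Variable o : G -> G -> bool.
Hypothesis oC : forall u v, u <> v -> o v u = ~~ o u v.

Let adj_neq (u v : G) : adj u v -> u <> v.
Proof. by move=> uv vu; apply: (@adj_irrefl _ u); rewrite {2}vu. Qed.

(* The internal vertex at distance [i] from [u] on the path replacing [uv] is
   named after the orientation of [uv] chosen by [o], so it gets only one name. *)
Definition point_name (u v : G) (i : nat) : G + G * G * nat :=
  if i == 0 then inl u else if len u v <= i then inl v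
  else if o u v then inr (u, v, i) else inr (v, u, len u v - i).

(** The sum type also holds triples that lie on no edge, so only the names in use are kept. *)
Definition names_point (x : G + G * G * nat) : Prop :=
  (exists w, x = inl w) \/ (exists u v i, adj u v /\ x = point_name u v i).

Definition point : Type := {x | names_point x}.

Definition branch_point (u : G) : point :=
  exist _ (inl u) (or_introl (ex_intro _ u erefl)).

(** The value [branch_point u] is a default, reached only if [uv] is not an edge. *)
Definition path_point (u v : G) (i : nat) : point :=
  if pselect (names_point (point_name u v i)) is left h then exist _ _ h
  else branch_point u.

Lemma point_inj (x y : point) : proj1_sig x = proj1_sig y -> x = y.
Proof. by apply: eq_sig_hprop => z a b; apply: Prop_irrelevance. Qed.

Lemma path_pointE (u v : G) i :
  adj u v -> proj1_sig (path_point u v i) = point_name u v i.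
Proof.
rewrite /path_point; case: pselect => // nuv uv.
by case: nuv; right; exists u, v, i.
Qed.

Lemma point_name_rev (u v : G) i : adj u v -> i <= len u v ->
  point_name v u i = point_name u v (len u v - i).
Proof.
move=> uv ile; rewrite /point_name len_sym // (oC (adj_neq uv)).
have := len_gt0 uv.
case: (eqVneq i 0) => [->|i0] l0.
  by rewrite subn0 leqnn [RHS]ifF //; lia.
case: (leqP (len u v) i) => li; first by rewrite (_ : _ - _ == 0) //; lia.
have -> : (len u v - i == 0) = false by lia.
have -> : (len u v <= len u v - i) = false by lia.
by rewrite subKn //; case: (o u v).
Qed.

Lemma point_name_new (u v : G) i : 0 < i < len u v ->
  point_name u v i = if o u v then inr (u, v, i) else inr (v, u, len u v - i).
Proof.
move=> il; rewrite /point_name.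
have -> : (i == 0) = false by lia.
by have -> : (len u v <= i) = false by lia.
Qed.

Definition point_adj (x y : point) : Prop := exists u v i,
  [/\ adj u v, i < len u v, x = path_point u v i & y = path_point u v i.+1].

Lemma point_adj_sym x y : point_adj x y -> point_adj y x.
Proof.
move=> [u [v [i [uv il -> ->]]]].
exists v, u, (len u v - i.+1); split.
- exact: adj_sym.
- by rewrite (len_sym uv); lia.
- apply: point_inj; rewrite !path_pointE//; last exact: adj_sym.
  rewrite (point_name_rev uv); last lia.
  by congr point_name; lia.
- apply: point_inj; rewrite !path_pointE//; last exact: adj_sym.
  rewrite (point_name_rev uv); last lia.
  by congr point_name; lia.
Qed.

Lemma point_adj_irrefl x : ~ point_adj x x.
Proof.
move=> [u [v [i [uv il -> /(congr1 (@proj1_sig _ _))]]]].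
rewrite !path_pointE // /point_name.
have := adj_neq uv.
case: eqP => [i0|i0]; case: ifP => //= l1.
- by move=> ? [].
- by case: (o u v).
- by lia.
- by case: (o u v) => _; case: ifP => // _ [] *; lia.
Qed.

Definition subdivided : graph := Graph point_adj_sym point_adj_irrefl.

Lemma subdividedP :
  @is_subdivision G subdivided branch_point len path_point.
Proof.
split => //.
- by move=> u v [].
- by move=> u v uv; apply: point_inj; rewrite path_pointE.
- move=> u v uv; apply: point_inj; rewrite path_pointE // /point_name leqnn.
  by rewrite ifF //; have := len_gt0 uv; lia.
- move=> u v i uv il; apply: point_inj; rewrite !path_pointE //.
    exact: point_name_rev.
  exact: adj_sym.
- move=> u v i w uv il /(congr1 (@proj1_sig _ _)); rewrite path_pointE //.
  by rewrite point_name_new //; case: (o u v).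
- move=> u v i u' v' j uv il uv' jl /(congr1 (@proj1_sig _ _)).
  rewrite !path_pointE // !point_name_new //.
  have lu := len_sym uv; have lu' := len_sym uv'.
  (* Equal names mean the same path if [o] orients both pairs alike, and reversed paths
     otherwise. *)
  case: (o u v); case: (o u' v') => -[] *; subst; [left|right|right|left];
    split => //; lia.
- move=> [x x_name]; case: (x_name) => [[w xw]|[u [v [i [uv xuv]]]]].
    by left; exists w; apply: point_inj.
  case: (posnP i) => [i0|i0].
    by left; exists u; apply: point_inj; rewrite /= xuv i0.
  case: (leqP (len u v) i) => il.
    left; exists v; apply: point_inj; rewrite /= xuv /point_name il ifF //; lia.
  right; exists u, v, i; split => //; first by rewrite i0.
  by apply: point_inj; rewrite path_pointE.
Qed.

End SubdivisionExists.

Lemma subdivision_exists (G : graph) (len : G -> G -> nat) :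
  (forall u v, adj u v -> 0 < len u v) ->
  (forall u v, adj u v -> len v u = len u v) ->
  exists (H : graph) (f : G -> H) p, is_subdivision f len p.
Proof.
move=> len_gt0 len_sym; have [o oC] := orientation_exists G.
by exists (subdivided len_gt0 len_sym oC); do 2!eexists; apply: subdividedP.
Qed.

(** * Walks and distances *)

Lemma walk_cat (G : graph) m n (u v x : G) :
  walk m u v -> walk n v x -> walk (m + n) u x.
Proof.
elim: m u => [|m IHm] u /=; first by move=> ->.
by move=> [y uy yv] vx; exists y => //; apply: IHm.
Qed.

Lemma walk1 (G : graph) (u v : G) : adj u v -> walk 1 u v.
Proof. by exists v. Qed.

Lemma walk_sym (G : graph) n (u v : G) : walk n u v -> walk n v u.
Proof.
elim: n u => [|n IHn] u; first by move=> /= ->.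
move=> [y uy /IHn yv]; rewrite -[n.+1]addn1; apply: walk_cat yv _.
exact/walk1/adj_sym.
Qed.

Lemma robber_walk (G : graph) (r : nat -> G) : robber_path r ->
  forall s t, s <= t -> exists2 m, m <= t - s & walk m (r s) (r t).
Proof.
move=> rP s; elim=> [|t IHt] st.
  by exists 0; rewrite //= (_ : s = 0) //; lia.
have [->|st'] : s = t.+1 \/ s <= t by lia.
  by exists 0.
have [m mt wm] := IHt st'.
have [->|rt] := rP t; first by exists m => //; lia.
by exists m.+1; [lia | rewrite -[m.+1]addn1; apply: walk_cat wm (walk1 rt)].
Qed.

Lemma distP (G : graph) (u v : G) n : walk n u v ->
  exists2 k, dist u v = Some k &
    walk k u v /\ forall m, walk m u v -> k <= m.
Proof.
rewrite /dist => uv; case: pselect => [uvP|[]]; last first.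
  by exists n; apply/asboolP.
case: ex_minnP => k /asboolP kP kmin; exists k => //; split => // m um.
by apply: kmin; apply/asboolP.
Qed.

Lemma dist_walk (G : graph) (u v : G) k : dist u v = Some k -> walk k u v.
Proof.
rewrite /dist; case: pselect => // uvP.
by case: ex_minnP => m /asboolP mP _ [<-].
Qed.

(** Carries a distance bound from the actual robber over to any robber who gives the same answer. *)
Lemma eq_dist_walk (G : graph) (u v v' : G) n :
  dist u v = dist u v' -> walk n u v -> exists2 m, m <= n & walk m u v'.
Proof.
move=> duv uv; have [k dk [_ kmin]] := distP uv.
exists k; first exact: kmin.
by apply: dist_walk; rewrite -duv.
Qed.

(** * Distances in a subdivision *)

Section Subdivision.
Variables (G H : graph) (f : G -> H) (len : G -> G -> nat).
Variable p : G -> G -> nat -> H.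
Hypothesis sub : is_subdivision f len p.

Lemma path_adj (u v : G) i :
  adj u v -> i < len u v -> adj (p u v i) (p u v i.+1).
Proof. by move=> uv il; apply/(subdiv_adj sub); exists u, v, i. Qed.

Lemma path_walk (u v : G) i j :
  adj u v -> i <= j <= len u v -> walk (j - i) (p u v i) (p u v j).
Proof.
move=> uv; elim: j => [|j IHj] ij.
  by rewrite (_ : i = 0) //; lia.
have [->|ij'] : i = j.+1 \/ i <= j by lia.
  by rewrite subnn.
rewrite subSn // -addn1; apply: walk_cat (IHj _) (walk1 (path_adj uv _)); lia.
Qed.

Lemma path_walk_start (u v : G) i :
  adj u v -> i <= len u v -> walk i (f u) (p u v i).
Proof.
by move=> uv il; rewrite -(subdiv_start sub uv) -{1}[i]subn0; apply: path_walk.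
Qed.

Lemma path_walk_end (u v : G) i :
  adj u v -> i <= len u v -> walk (len u v - i) (f v) (p u v i).
Proof.
move=> uv il; apply: walk_sym; rewrite -(subdiv_end sub uv).
by apply: path_walk => //; rewrite il leqnn.
Qed.

Lemma edge_walk (u v : G) : adj u v -> walk (len u v) (f u) (f v).
Proof.
by move=> uv; rewrite -(subdiv_end sub uv); apply: path_walk_start.
Qed.

Lemma adj_internal (u v : G) i y : adj u v -> 0 < i < len u v ->
  adj (p u v i) y -> y = p u v i.-1 \/ y = p u v i.+1.
Proof.
move=> uv il /(subdiv_adj sub) [u' [v' [j [uv' jl pp ->]]]].
case: (posnP j) => [j0|j0].
  move: pp; rewrite j0 (subdiv_start sub uv') => pp.
  by have := subdiv_new sub (w := u') uv il.
have jl' : 0 < j < len u' v' by rewrite j0.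
have [[-> -> ->]|[uE vE jE]] := subdiv_disjoint sub uv il uv' jl' pp.
  by right.
left; rewrite uE vE jE (subdiv_rev sub uv); last by lia.
by congr p; lia.
Qed.

Lemma adj_branch (u : G) y :
  adj (f u) y -> exists2 v, adj u v & y = p u v 1.
Proof.
move=> /(subdiv_adj sub) [u' [v' [j [uv' jl pp ->]]]].
case: (posnP j) => [j0|j0].
  move: pp; rewrite j0 (subdiv_start sub uv') => /(subdiv_inj sub) ->.
  by exists v'.
have := subdiv_new sub (i := j) (w := u) uv'.
by rewrite -pp j0 => /(_ jl).
Qed.

(** A branch vertex is never internal, so the walk must leave the path through one of its ends. *)
Lemma walk_exit (u v y : G) n i : adj u v -> i <= len u v ->
  walk n (p u v i) (f y) ->
  (exists2 m, walk m (f u) (f y) & i + m <= n) \/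
  (exists2 m, walk m (f v) (f y) & len u v - i + m <= n).
Proof.
move=> uv; elim: n i => [|n IHn] i il.
  move=> w0; case: (posnP i) => [i0|i0].
    left; exists 0; last lia.
    by move: w0; rewrite i0 (subdiv_start sub uv).
  have [iE|il'] : i = len u v \/ 0 < i < len u v by lia.
    right; exists 0; last lia.
    by rewrite -(subdiv_end sub uv) -iE.
  by have := subdiv_new sub (w := y) uv il'.
case: (posnP i) => [->|i0].
  by rewrite (subdiv_start sub uv) => wn; left; exists n.+1.
have [->|il'] : i = len u v \/ 0 < i < len u v by lia.
  rewrite (subdiv_end sub uv) => wn; right; exists n.+1 => //.
  by rewrite subnn.
move=> [z /(adj_internal uv il') [] -> /IHn wz].
  by have [[m wm mn]|[m wm mn]] := wz ltac:(lia);
    [left|right]; exists m => //; lia.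
by have [[m wm mn]|[m wm mn]] := wz ltac:(lia);
    [left|right]; exists m => //; lia.
Qed.

(** Strong induction: a walk that comes back to [x] before crossing an edge is replaced by its
    shorter remainder. *)
Lemma walk_first_edge (x y : G) n : walk n (f x) (f y) -> x <> y ->
  exists z m, [/\ adj x z, walk m (f z) (f y) & len x z + m <= n].
Proof.
move=> wn xy; elim/ltn_ind: n wn => -[_ /(subdiv_inj sub)//|n IHn].
move=> [q /adj_branch [z xz ->] wq].
have l0 := subdiv_len sub xz.
have [[m wm mn]|[m wm mn]] := walk_exit xz l0 wq; last first.
  by exists z, m; split => //; lia.
have [z' [m' [xz' wm' mm']]] := IHn _ (ltac:(lia) : m < n.+1) wm.
by exists z', m'; split => //; lia.
Qed.

Lemma path_of_walk (a b : G) i n q : adj a b ->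
  walk n (p a b i) q -> n <= i -> i + n <= len a b ->
  exists j, [/\ i <= j + n, j <= i + n & q = p a b j].
Proof.
move=> ab; elim: n i => [|n IHn] i /=.
  by move=> <-; exists i; split => //; lia.
move=> [z az zq] ni nl.
case: (adj_internal ab _ az) => [|zE|zE]; first lia.
  rewrite zE in zq; have [||j [ij ji ->]] := IHn _ zq; try lia.
  by exists j; split => //; lia.
rewrite zE in zq; have [||j [ij ji ->]] := IHn _ zq; try lia.
by exists j; split => //; lia.
Qed.

(** * Edges as long as the larger weight of their ends *)

Section Weights.
Variable w : G -> nat.
Hypothesis len_w : forall u v, adj u v -> len u v = maxn (w u) (w v).

(** At either end the walk crosses a whole edge, which is at least as long as the weight of that
    end. *)
Lemma walk_branch_ge (x y : G) n :
  walk n (f x) (f y) -> x <> y -> maxn (w x) (w y) <= n.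
Proof.
move=> wn xy; rewrite geq_max; apply/andP; split.
  have [z [m [xz _]]] := walk_first_edge wn xy.
  by rewrite len_w //; lia.
have [|z [m [yz _]]] := walk_first_edge (walk_sym wn); first exact: nesym.
by rewrite len_w //; lia.
Qed.

Lemma walk_edge_ge (x y : G) n : adj x y -> walk n (f x) (f y) -> len x y <= n.
Proof.
move=> xy /walk_branch_ge; rewrite len_w //; apply.
by move=> e; apply: (@adj_irrefl _ x); rewrite {2}e.
Qed.

(* A walk along a detour ends with an edge at [v], and starts with an edge at
   [u]; one of these two edges is at least as long as [uv]. *)
Lemma walk_detour_ge (u v u' v' : G) m n : adj u v -> adj u' v' ->
  ~ (u' = u /\ v' = v) -> walk m (f u) (f u') -> walk n (f v') (f v) ->
  len u v + minn (w u) (w v) <= m + len u' v' + n.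
Proof.
move=> uv uv' ne wm wn; rewrite !len_w //.
have [e1|ne1] := pselect (u = u'); have [e2|ne2] := pselect (v' = v).
- by case: ne.
- by have := walk_branch_ge wn ne2; subst; lia.
- by have := walk_branch_ge wm ne1; subst; lia.
- by have := walk_branch_ge wm ne1; have := walk_branch_ge wn ne2; lia.
Qed.

(** The way round through [v] already costs [len u v]. *)
Lemma path_dist (u v : G) i n :
  adj u v -> i <= len u v -> walk n (f u) (p u v i) -> i <= n.
Proof.
move=> uv il /walk_sym /(walk_exit uv il) [[m wm mn]|[m wm mn]]; first lia.
by have := walk_edge_ge uv (walk_sym wm); lia.
Qed.

(** Leaving the edges at [x] requires passing another branch vertex, at distance at least [w x]. *)
Lemma star_of_ball (x : G) q n : walk n (f x) q -> n < w x ->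
  q = f x \/ exists z i, [/\ adj x z, i <= len x z, i <= n & q = p x z i].
Proof.
move=> wn nx; have [[y qE]|[a [b [i [ab il qE]]]]] := subdiv_cover sub q.
  left; rewrite qE; congr f; rewrite qE in wn.
  have [->//|ne] := pselect (x = y).
  by have := walk_branch_ge wn ne; lia.
right; move: wn => /walk_sym; rewrite qE => /(walk_exit ab).
case=> [|[m wm mn]|[m wm mn]]; first lia.
  have [e|ne] := pselect (a = x).
    by exists b, i; rewrite -e; split => //; lia.
  by have := walk_branch_ge wm ne; lia.
have [e|ne] := pselect (b = x); last by have := walk_branch_ge wm ne; lia.
exists a, (len a b - i); rewrite -e (subdiv_len_sym sub ab); split => //.
- exact: adj_sym.
- lia.
- lia.
- by rewrite (subdiv_rev sub ab) ?subKn //; lia.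
Qed.


Lemma path_dist_end (u v : G) i n : adj u v -> i <= len u v ->
  walk n (f v) (p u v i) -> len u v - i <= n.
Proof.
move=> uv il wn; apply: (path_dist (adj_sym uv)).
  by rewrite (subdiv_len_sym sub uv) leq_subr.
by rewrite (subdiv_rev sub uv) ?subKn // leq_subr.
Qed.

(** On the leg [xy] the distance to [y] fixes the position. From another leg [xz], the way through
    [x] is too long unless both points are [f x], and the way through [z] costs at least
    [w x + w y - c], which exceeds [len x y]. *)
Lemma star_probe (x y : G) c i n q : adj x y -> c < minn (w x) (w y) ->
  i <= c -> walk n (f x) q -> n <= c ->
  dist (f y) (p x y i) = dist (f y) q -> q = p x y i.
Proof.
move=> xy cw ic wn nc dq.
have lxy := len_w xy.
have [z [j [xz jl jn qE]]] :
    exists z j, [/\ adj x z, j <= len x z, j <= n & q = p x z j].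
  have [|->|[z [j zP]]] := star_of_ball wn; first lia; last by exists z, j.
  by exists y, 0; split => //; rewrite (subdiv_start sub xy).
rewrite {}qE in dq *; have il : i <= len x y by lia.
have [m mi wm] := eq_dist_walk dq (path_walk_end xy il).
have [zy|zy] := pselect (z = y).
  subst z; congr p; have := path_dist_end xy jl wm.
  have [m' mj wm'] := eq_dist_walk (esym dq) (path_walk_end xy jl).
  by have := path_dist_end xy il wm'; lia.
have lxz := len_w xz.
have [[m' wm' mj]|[m' wm' mj]] := walk_exit xz jl (walk_sym wm).
  have lm := walk_edge_ge xy wm'.
  have [i0 j0] : i = 0 /\ j = 0 by lia.
  by rewrite i0 j0 !(subdiv_start sub).
by have := walk_branch_ge wm' zy; lia.
Qed.

Lemma robber_leg (r : nat -> H) t (x z : G) i k : robber_path r -> adj x z ->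
  0 < i < len x z -> r t = p x z i -> (forall s, s <= k -> r (t + s) <> f z) ->
  (exists2 s, 0 < s <= k & r (t + s) = f x) \/
  (exists2 j, 0 < j < len x z & r (t + k) = p x z j).
Proof.
move=> rP xz il rt; elim: k => [|k IHk] rz.
  by right; exists i => //; rewrite addn0.
have {IHk} [|[s sk rs]|[j jl rj]] := IHk.
- by move=> s sk; apply: rz; lia.
- by left; exists s => //; lia.
rewrite addnS; have [->|] := rP (t + k); first by right; exists j.
rewrite rj => /(adj_internal xz jl) [] rE.
  case: (posnP j.-1) => j0; last by right; exists j.-1 => //; lia.
  left; exists k.+1; first lia.
  by rewrite addnS rE j0 (subdiv_start sub).
have [jE|] : j.+1 = len x z \/ 0 < j.+1 < len x z by lia.
  by case: (rz k.+1) => //; rewrite addnS rE jE (subdiv_end sub).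
by right; exists j.+1.
Qed.

(** * Locating a robber who has no time to cover an edge *)

Variable probe : nat -> G.

(** Probe [t] is answered from the position at round [t.+1], round 0 being left for the probe at the
    root. *)
Definition found_at (r : nat -> H) n : Prop :=
  forall r', robber_path r' ->
    (forall t, t < n ->
       dist (f (probe t)) (r t.+1) = dist (f (probe t)) (r' t.+1)) ->
  r' n = r n.

(** Between the probe of [x] and that of [z], only neighbours of [x] are probed. *)
Definition star_probed T (x : G) : Prop :=
  exists t, [/\ t < T, probe t = x & forall z, adj x z ->
    exists k, [/\ t + k.+1 < T, probe (t + k.+1) = z &
      forall s, s <= k -> adj x (probe (t + s.+1))]].

(* Near [x], the robber cannot change legs without stepping on [x], where the
   probe of any neighbour of [x] reveals him. *)
Lemma found_near T (r : nat -> H) (x : G) m : robber_path r ->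
  star_probed T x -> 8 * T < w x -> (forall y, adj x y -> 8 * T < w y) ->
  walk m (f x) (r 0) -> m <= 6 * T -> exists n, found_at r n.
Proof.
move=> rP [t0 [tT px pn]] wx wy wm mT.
have near t : t <= T -> exists2 m', m' <= 7 * T & walk m' (f x) (r t).
  move=> t_le; have [k kt wk] := robber_walk rP (leq0n t).
  by exists (m + k); [lia | apply: walk_cat wm wk].
(* The answer for [x] gives [r'] the bound [7 * T] at round [t0.+1], and at most [T] moves
   follow. *)
have near' r' : robber_path r' ->
    (forall t, t < t0.+1 ->
       dist (f (probe t)) (r t.+1) = dist (f (probe t)) (r' t.+1)) ->
    forall t, t0.+1 <= t <= T ->
    exists2 m', m' <= 8 * T & walk m' (f x) (r' t).
  move=> r'P dr t /andP[t0t t_le]; have [k kt wk] := near t0.+1 tT.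
  have := dr t0 (leqnn _); rewrite px => /eq_dist_walk /(_ wk) [k' kk' wk'].
  have [l lt wl] := robber_walk r'P t0t.
  by exists (k' + l); [lia | apply: walk_cat wk' wl].
have at_x : r t0.+1 = f x -> exists n, found_at r n.
  move=> rx; exists t0.+1 => r' r'P dr; have := dr t0 (leqnn _).
  rewrite px rx => /eq_dist_walk /(_ (erefl : walk 0 (f x) (f x))) [k k0].
  by have -> : k = 0 by lia.
have [k kT wk] := near t0.+1 tT.
have [|/at_x//|[z [i [xz il ik rE]]]] := star_of_ball wk; first lia.
case: (posnP i) => i0.
  by apply: at_x; rewrite rE i0 (subdiv_start sub).
have lxz := len_w xz.
have [K [KT pK adjK]] := pn z xz.
have il' : 0 < i < len x z by lia.
(* The edge [xz] is longer than [8 * T], whereas the robber stays within [7 * T] of [f x]. *)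
have rz s : s <= K.+1 -> r (t0.+1 + s) <> f z.
  move=> sK rz; have [|k' k'T] := near (t0.+1 + s); first lia.
  by rewrite rz => /(walk_edge_ge xz); lia.
case: (robber_leg rP xz il' rE rz) => [[s sK rs]|[j jl rj]].
- exists (t0.+1 + s) => r' r'P dr.
  have [||k' k'T wk'] := near' _ r'P _ (t0.+1 + s); [|lia|].
    by move=> t tt; apply: dr; lia.
  have sS : t0.+1 + s = (t0 + s.-1.+1).+1 by lia.
  (* The vertex probed while the robber is on [f x] is some neighbour [y]; [f x] is position 0 on
     the leg [xy]. *)
  have xy : adj x (probe (t0 + s.-1.+1)) by apply: adjK; lia.
  have := dr (t0 + s.-1.+1); rewrite -sS rs -(subdiv_start sub xy).
  move=> /(_ ltac:(lia)); apply: (star_probe xy _ _ wk' k'T) => //.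
  by have := wy _ xy; lia.
- exists (t0.+1 + K.+1) => r' r'P dr.
  have [||k' k'T wk'] := near' _ r'P _ (t0.+1 + K.+1); [|lia|].
    by move=> t tt; apply: dr; lia.
  have := dr (t0 + K.+1); rewrite -addSn rj pK => /(_ ltac:(lia)).
  apply: (star_probe xz _ _ wk' k'T); first by have := wy _ xz; lia.
  have [|k2 k2T] := near (t0.+1 + K.+1); first lia.
  by rewrite rj => /(path_dist xz); lia.
Qed.

(* A vertex other than [a] and [b] is at distance at least [len a b] from one of
   them, so a robber as close to both as the hypotheses say is between them. *)
Lemma edge_probe (a b : G) c i q m : adj a b -> c < minn (w a) (w b) ->
  c < i < len a b -> dist (f a) (p a b i) = dist (f a) q ->
  walk m (f b) q -> m <= len a b - i + c -> q = p a b i.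
Proof.
move=> ab cw ci dq wm mc.
have il : i <= len a b by lia.
have [k ki wk] := eq_dist_walk dq (path_walk_start ab il).
have lab := len_w ab.
(* The heavier end of [ab] is at distance at least [len a b] from every other branch vertex. *)
have far_from_one y s t : walk s (f y) (f a) -> walk t (f y) (f b) ->
    s < len a b -> t < len a b -> False.
  move=> ws wt sl tl; have [ab_le|ba_le] := leqP (w a) (w b).
    have [yb|yb] := pselect (y = b); last by have := walk_branch_ge wt yb; lia.
    by move: ws; rewrite yb => /walk_sym /(walk_edge_ge ab); lia.
  have [ya|ya] := pselect (y = a); last by have := walk_branch_ge ws ya; lia.
  by move: wt; rewrite ya => /(walk_edge_ge ab); lia.
(* On an edge other than [ab], the two walks would form a detour of length at most [len a b + c],
   which is too short. *)
have between a' b' j s t : adj a' b' -> j <= len a' b' -> q = p a' b' j ->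
    walk s (f a') (f a) -> walk t (f b') (f b) ->
    j + s <= k -> len a' b' - j + t <= m -> q = p a b i.
  move=> ab' jl qE ws wt sk tm.
  have [[aE bE]|ne] := pselect (a' = a /\ b' = b); last first.
    by have := walk_detour_ge ab ab' ne (walk_sym ws) wt; lia.
  subst a' b'; rewrite qE in dq *; congr p.
  have [l lj wl] := eq_dist_walk (esym dq) (path_walk_start ab jl).
  by have := path_dist ab il wl; lia.
have [[y qE]|[a' [b' [j [ab' jl qE]]]]] := subdiv_cover sub q.
  rewrite qE in wk wm.
  by case: (far_from_one y _ _ (walk_sym wk) (walk_sym wm)); lia.
have {}jl : j <= len a' b' by lia.
move: (wk) (wm) => /walk_sym wk' /walk_sym wm'; rewrite qE in wk' wm'.
case: (walk_exit ab' jl wk') => -[s ws sk];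
  case: (walk_exit ab' jl wm') => -[t wt tm].
- by case: (far_from_one a' _ _ ws wt); lia.
- exact: between ab' jl qE ws wt sk tm.
- have ba' := adj_sym ab'; have l' := subdiv_len_sym sub ab'.
  apply: (between b' a' (len a' b' - j) s t ba') => //; try lia.
  by rewrite (subdiv_rev sub ab') ?subKn //; lia.
- by case: (far_from_one b' _ _ ws wt); lia.
Qed.

(** The earlier probe at [b] confines the robber to the edge; the later one at [a] then gives his
    position. *)
Lemma found_mid T (r : nat -> H) (a b : G) i ta tb : robber_path r ->
  adj a b -> 8 * T < w a -> 8 * T < w b -> 6 * T < i -> i + 6 * T < len a b ->
  r 0 = p a b i -> tb <= ta < T -> probe ta = a -> probe tb = b ->
  exists n, found_at r n.
Proof.
move=> rP ab wa wb iT iT' r0 tab pa pb.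
have mid t : t <= T ->
    exists j, [/\ i <= j + T, j <= i + T & r t = p a b j].
  move=> t_le; have [k kt wk] := robber_walk rP (leq0n t).
  rewrite r0 in wk; have [||j [ij ji ->]] := path_of_walk ab wk; try lia.
  by exists j; split => //; lia.
exists ta.+1 => r' r'P dr.
have [|ja [ija jia rja]] := mid ta.+1; first lia.
have [|jb [ijb jib rjb]] := mid tb.+1; first lia.
have := dr tb ltac:(lia); rewrite pb rjb => /eq_dist_walk.
have jbl : jb <= len a b by lia.
move=> /(_ _ (path_walk_end ab jbl)) [k kl wk].
have [|l lt wl] := robber_walk r'P (_ : tb.+1 <= ta.+1); first lia.
have := dr ta (leqnn _); rewrite pa rja => dq.
(* In [3 * T], the gap between [ja] and [jb] takes [2 * T], and the moves of [r'] between the probes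
   take [T]. *)
apply: (edge_probe (c := 3 * T)) dq (walk_cat wk wl) _ => //; lia.
Qed.

(** Within [6 * T] of an end use [found_near]; elsewhere use [found_mid], reversing the edge if [a]
    is probed before [b]. *)
Lemma found_on_edge T (r : nat -> H) (a b : G) i : robber_path r -> adj a b ->
  (forall x, x = a \/ x = b -> [/\ star_probed T x, 8 * T < w x &
    forall y, adj x y -> 8 * T < w y]) ->
  i <= len a b -> r 0 = p a b i -> exists n, found_at r n.
Proof.
move=> rP ab ends il r0.
have [pa wa na] := ends a (or_introl erefl).
have [pb wb nb] := ends b (or_intror erefl).
case: (leqP i (6 * T)) => iT.
  apply: (found_near rP pa wa na _ iT).
  by rewrite r0; apply: path_walk_start.
case: (leqP (len a b) (i + 6 * T)) => iT'.
  apply: (found_near rP pb wb nb (m := len a b - i)); last lia.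
  by rewrite r0; apply: path_walk_end.
have [ta [taT pta _]] := pa; have [tb [tbT ptb _]] := pb.
case: (leqP tb ta) => tab.
  by apply: (@found_mid T r a b i ta tb) => //; lia.
have ba := adj_sym ab; have lba := subdiv_len_sym sub ab.
apply: (@found_mid T r b a (len a b - i) tb ta) => //; try lia.
by rewrite r0 (subdiv_rev sub ab) ?subKn //; lia.
Qed.

End Weights.
End Subdivision.

(** * From a schedule of probes to a strategy *)

Lemma answers_head (G : graph) K (s : strategy G K) r n : exists h,
  size h = n /\ answers s r n.+1 = (fun k => dist (s [::] k) (r 0)) :: h.
Proof.
elim: n => [|n [h [hn hE]]]; first by exists [::].
exists (rcons h (fun k => dist (s (answers s r n.+1) k) (r n.+1))).
by rewrite size_rcons hn -rcons_cons -hE.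
Qed.

Lemma eq_answers (G : graph) K (s : strategy G K) r r' n :
  answers s r' n = answers s r n -> forall t k, t < n ->
  dist (s (answers s r t) k) (r' t) = dist (s (answers s r t) k) (r t).
Proof.
elim: n => [//|n IHn] /= /rcons_inj [ans prb] t k tn.
have [->|{}tn] : t = n \/ t < n by lia.
  by move/(congr1 (fun a => a k)): prb; rewrite ans.
exact: IHn.
Qed.

(** The first answer selects a fixed schedule, and the length of the history tells which probe comes
    next. *)
Lemma cops_win_schedule (G : graph) (a : G) :
  (forall d, exists probe : nat -> G, forall r, robber_path r ->
     dist a (r 0) = d -> exists n, forall r', robber_path r' ->
     (forall t, t < n -> dist (probe t) (r t.+1) = dist (probe t) (r' t.+1)) ->
     r' n = r n) ->
  cops_win G 'I_1.
Proof.
move=> /choice [probe probeP].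
pose s : strategy G 'I_1 := fun h _ =>
  if h is d :: h' then probe (d ord0) (size h') else a.
exists s => r rP; have [n rn] := probeP _ r rP erefl.
exists n => r' r'P /eq_answers ans; apply: rn => // t tn.
have [h [ht hE]] := answers_head s r t.
by have := ans t.+1 ord0 tn; rewrite hE /= ht => ->.
Qed.

(** * Levels and neighbour lists *)

Lemma level_exists (G : graph) (v0 : G) : connected G -> exists lev : G -> nat,
  [/\ forall x, lev x = 0 -> x = v0, lev v0 = 0,
      forall x y, adj x y -> lev y <= (lev x).+1 &
      forall x n, lev x = n.+1 -> exists2 y, adj y x & lev y = n].
Proof.
move=> [_ G_conn].
(* The level of [x] is its distance from [v0]. *)
have /choice [lev levP] (x : G) :
    exists n, walk n v0 x /\ forall m, walk m v0 x -> n <= m.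
  have [n /distP [k _ kP]] := G_conn v0 x; by exists k.
exists lev; split.
- by move=> x x0; have [] := levP x; rewrite x0.
- by have [_ /(_ 0 erefl)] := levP v0; lia.
- move=> x y xy; have [_] := levP y; apply.
  have [wx _] := levP x; rewrite -addn1; exact: walk_cat wx (walk1 xy).
- move=> x n xn; have [] := levP x; rewrite xn => /walk_sym /= [y xy wy] xmin.
  exists y; first exact: adj_sym.
  have [wy' ymin] := levP y.
  have := ymin _ (walk_sym wy); have := xmin (lev y).+1; rewrite -addn1.
  by move=> /(_ (walk_cat wy' (walk1 (adj_sym xy)))); lia.
Qed.

(** [{classic G}] supplies the decidable equality needed for membership in sequences. *)
Lemma neighbours_exist (G : graph) : locally_finite G ->
  exists nb : G -> seq {classic G}, forall u v, adj u v <-> v \in nb u.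
Proof.
move=> Gfin; suff /choice [nb nbP] : forall u : G, exists s : seq {classic G},
    forall v, adj u v <-> v \in s by exists nb.
move=> u.
have /finite_seqP [s sE] : @finite_set {classic G} [set v | adj u v]%classic.
  exact: Gfin.
by exists s => v; have := congr1 (fun A => A v) sE => /= ->.
Qed.

(** * The choice of the lengths *)

Section Construction.
Variables (G : graph) (v0 : G) (nb : {classic G} -> seq {classic G}).
Variable lev : G -> nat.
Hypothesis nbP : forall u v : G, adj u v <-> v \in nb u.
Hypothesis lev_eq0 : forall x, lev x = 0 -> x = v0.
Hypothesis lev0 : lev v0 = 0.
Hypothesis lev_adj : forall x y, adj x y -> lev y <= (lev x).+1.
Hypothesis lev_pred : forall x n,
  lev x = n.+1 -> exists2 y, adj y x & lev y = n.

Fixpoint ball (n : nat) : seq {classic G} :=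
  if n is k.+1 then ball k ++ flatten [seq nb x | x <- ball k]
  else [:: v0 : {classic G}].

Definition probes (n : nat) : seq {classic G} :=
  flatten [seq x :: nb x | x <- ball n].

(* The whole game takes at most [size (probes j)] rounds when the robber starts
   at levels up to [j], and edges at levels at least [j - 3] are longer. *)
Definition weight (j : nat) : nat := 8 * (size (probes j.+3)).+1.

(* The distance from [v0] to the vertices of level [n] in the subdivision. *)
Definition depth (n : nat) : nat := \sum_(i < n) weight i.+1.

Lemma mem_ball x n : lev x <= n -> (x : {classic G}) \in ball n.
Proof.
elim: n x => [|n IHn] x xn.
  by rewrite (lev_eq0 (x := x)) ?mem_seq1 //; lia.
rewrite mem_cat; have [/IHn ->//|{}xn] : lev x <= n \/ lev x = n.+1 by lia.
have [y yx yn] := lev_pred xn; apply/orP; right; apply/flatten_mapP.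
by exists y; [apply: IHn; rewrite yn | apply/nbP].
Qed.

Lemma size_probes m n : m <= n -> size (probes m) <= size (probes n).
Proof.
move=> /subnK <-; elim: (n - m) => // k /leq_trans -> //.
by rewrite addSn /probes /= map_cat flatten_cat size_cat leq_addr.
Qed.

Lemma weight_homo m n : m <= n -> weight m <= weight n.
Proof. by move=> mn; rewrite leq_mul2l ltnS size_probes. Qed.

Lemma star_probed_probes x n : lev x <= n ->
  star_probed (nth (v0 : {classic G}) (probes n)) (size (probes n)) x.
Proof.
move=> /mem_ball; rewrite /probes; elim: (ball n) => //= y s IHs.
rewrite in_cons => /orP[/eqP xy|/IHs [t [tT tx tn]]]; last first.
  exists (size (y :: nb y) + t); split.
  - by rewrite /= size_cat; lia.
  - by rewrite -cat_cons nth_cat ltnNge leq_addr /= addKn.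
  - move=> z /tn [k [kT kz kn]]; exists k; rewrite /= size_cat.
    split; first lia.
      by rewrite -addnA nth_cat ltnNge leq_addr /= addKn.
    by move=> i /kn; rewrite -addnA nth_cat ltnNge leq_addr /= addKn.
exists 0; split => //.
move=> z /nbP zx; rewrite /= -xy; exists (index (z : {classic G}) (nb x)).
have lt_z : index (z : {classic G}) (nb x) < size (nb x) by rewrite index_mem.
rewrite size_cat nth_cat lt_z nth_index //; split => //; first lia.
move=> i ik; have i_lt := leq_ltn_trans ik lt_z.
by rewrite nth_cat i_lt; apply/nbP/mem_nth.
Qed.

Lemma depthS n : depth n.+1 = depth n + weight n.+1.
Proof. by rewrite /depth big_ord_recr. Qed.

Lemma ltn_depth m n : m < n -> depth m < depth n.
Proof.
elim: n => // n IHn mn; rewrite depthS.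
have [->|/IHn] : m = n \/ m < n by lia.
  by rewrite /weight; lia.
by lia.
Qed.

Lemma leq_depth m n : m <= n -> depth m <= depth n.
Proof.
by rewrite leq_eqVlt => /orP[/eqP ->//|/ltn_depth/ltnW].
Qed.

Lemma depth_interval d : exists n, depth n <= d < depth n.+1.
Proof.
elim: d => [|d [n nd]].
  by exists 0; rewrite {1}/depth big_ord0 /=; have := ltn_depth (ltn0Sn 0); lia.
have [dn|dn] := ltnP d.+1 (depth n.+1); first by exists n; lia.
by exists n.+1; have := ltn_depth (ltnSn n.+1); lia.
Qed.

(** * Distances from the root in the subdivision *)

Definition edge_length (u v : G) : nat :=
  maxn (weight (lev u)) (weight (lev v)).

Variables (H : graph) (f : G -> H) (p : G -> G -> nat -> H).
Hypothesis sub : is_subdivision f edge_length p.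

Let len_w (u v : G) : adj u v ->
  edge_length u v = maxn (weight (lev u)) (weight (lev v)).
Proof. by []. Qed.

(** Read from [x], an edge of the walk goes down at most one level, and then costs at least
    [weight (lev x)]. *)
Lemma walk_depth_ge (x : G) n : walk n (f v0) (f x) -> depth (lev x) <= n.
Proof.
move=> /walk_sym; elim/ltn_ind: n x => n IHn x wn.
have [xv0|xv0] := pselect (x = v0).
  by rewrite xv0 lev0 /depth big_ord0.
have [z [k [xz wk kn]]] := walk_first_edge sub wn xv0.
have k_lt : k < n by have := subdiv_len sub xz; lia.
have zk := IHn _ k_lt _ wk; apply: leq_trans kn.
suff : depth (lev x) <= depth (lev z) + edge_length x z by lia.
have [xz_lev|xz_lev] := leqP (lev x) (lev z).
  by have := leq_depth xz_lev; lia.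
have xS : lev x = (lev z).+1 by have := lev_adj (adj_sym xz); lia.
by rewrite xS depthS -xS leq_add2l leq_maxl.
Qed.

(** Climb one level at a time: as weights grow with the level, an edge up to level [n.+1] has length
    exactly [weight n.+1]. *)
Lemma walk_depth (x : G) : walk (depth (lev x)) (f v0) (f x).
Proof.
move xn : (lev x) => n; elim: n x xn => [|n IHn] x xn.
  by rewrite (lev_eq0 xn) /depth big_ord0.
have [y yx yn] := lev_pred xn; rewrite depthS.
suff -> : weight n.+1 = edge_length y x.
  exact: walk_cat (IHn _ yn) (edge_walk sub yx).
by rewrite /edge_length xn yn; apply/esym/maxn_idPr/weight_homo.
Qed.

Lemma dist_on_edge (a b : G) i k : adj a b -> lev a <= lev b ->
  i <= edge_length a b -> dist (f v0) (p a b i) = Some k ->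
  depth (lev a) <= k <= depth (lev a).+1.
Proof.
move=> ab le_ab il dk; have wk := dist_walk dk.
have := leq_depth le_ab; have := lev_adj ab => lev_b dab.
apply/andP; split.
  case: (walk_exit sub ab il (walk_sym wk)) => -[m wm mk].
    by have := walk_depth_ge (walk_sym wm); lia.
  by have := walk_depth_ge (walk_sym wm); lia.
have wi := walk_cat (walk_depth a) (path_walk_start sub ab il).
have [k' dk' [_ /(_ _ wi)]] := distP wi.
move: dk'; rewrite dk => -[<-]; rewrite depthS.
have : edge_length a b <= weight (lev a).+1.
  by rewrite geq_max !weight_homo.
by lia.
Qed.

(** The first answer forces [lev a <= n <= (lev a).+1], so both ends belong to the probed ball.
    Their neighbours have level at least [n - 2], whence the shift by 3 in [weight]. *)
Lemma found_on_oriented_edge (r : nat -> H) (a b : G) i k n : robber_path r ->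
  adj a b -> lev a <= lev b -> i <= edge_length a b -> r 0 = p a b i ->
  dist (f v0) (r 0) = Some k -> depth n <= k < depth n.+1 ->
  exists m, found_at f (nth (v0 : {classic G}) (probes n.+1)) r m.
Proof.
move=> rP ab le_ab il r0; rewrite r0 => /(dist_on_edge ab le_ab il) ak nk.
have a_n : lev a <= n.
  by rewrite leqNgt; apply/negP => /leq_depth; lia.
have n_a : n <= (lev a).+1.
  by rewrite leqNgt; apply/negP => /ltn_depth; lia.
have b_a := lev_adj ab.
have long x : n <= (lev x).+2 -> 8 * size (probes n.+1) < weight (lev x).
  move=> nx; have := size_probes (_ : n.+1 <= (lev x).+3).
  by rewrite /weight; lia.
apply: (found_on_edge sub len_w rP ab _ il r0) => x xab.
have x_lev : n <= (lev x).+1 /\ lev x <= n.+1 by case: xab => ->; lia.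
split; first by apply: star_probed_probes; lia.
  by apply: long; lia.
by move=> y /adj_sym /lev_adj xy; apply: long; lia.
Qed.

(** A branch vertex on no edge is, by connectedness, the only vertex. *)
Lemma edge_or_isolated (q : H) : connected G ->
  (exists a b i,
     [/\ adj a b, lev a <= lev b, i <= edge_length a b & q = p a b i]) \/
  (forall q' : H, q' = q).
Proof.
move=> [_ G_conn].
have orient a b i : adj a b -> i <= edge_length a b -> q = p a b i ->
    exists a b i,
      [/\ adj a b, lev a <= lev b, i <= edge_length a b & q = p a b i].
  move=> ab il qE; have [le_ab|/ltnW le_ba] := leqP (lev a) (lev b).
    by exists a, b, i.
  exists b, a, (edge_length a b - i); rewrite (subdiv_len_sym sub ab).
  rewrite leq_subr (subdiv_rev sub ab) ?leq_subr // subKn //.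
  by split => //; apply: adj_sym.
have [[x qE]|[a [b [i [ab il qE]]]]] := subdiv_cover sub q; last first.
  by left; apply: orient ab _ qE; lia.
have [[z xz]|x_alone] := pselect (exists z, adj x z).
  by left; apply: (orient x z 0) => //; rewrite (subdiv_start sub xz).
have only_x y : x = y.
  have [[|n] //= [z xz _]] := G_conn x y.
  by case: x_alone; exists z.
right=> q'; rewrite qE.
have [[y ->]|[a [b [i [ab _ _]]]]] := subdiv_cover sub q'.
  by rewrite (only_x y).
by case: x_alone; exists b; rewrite (only_x a).
Qed.

Lemma subdivision_cops_win : connected G -> cops_win H 'I_1.
Proof.
move=> G_conn; apply: (cops_win_schedule (a := f v0)) => d.
have [n dn] : exists n, forall k, d = Some k -> depth n <= k < depth n.+1.
  (* For [None] the condition on [n] is void, and 0 is a default. *)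
  case: d => [k|]; last by exists 0.
  by have [n kn] := depth_interval k; exists n => _ [<-].
exists (fun t => f (nth (v0 : {classic G}) (probes n.+1) t)) => r rP rd.
have [|alone] := edge_or_isolated (r 0) G_conn; last first.
  by exists 0 => r' _ _; apply: alone.
move=> [a [b [i [ab le_ab il rE]]]].
have w0 := walk_cat (walk_depth a) (path_walk_start sub ab il).
have [k dk _] := distP w0.
apply: (found_on_oriented_edge rP ab le_ab il rE (k := k)).
  by rewrite rE.
by apply: dn; rewrite -rd rE.
Qed.

End Construction.

(** * The localization number of the subdivision *)

Lemma card_I1_le (J : Type) : inhabited J -> ([set: 'I_1] #<= [set: J])%card.
Proof.
move=> [j]; have -> : [set: 'I_1]%classic = [set ord0]%classic.
  by apply/seteqP; split=> x //= _; apply: ord1.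
have /card_eqPle[le_j _] := eq_card1 (ord0 : 'I_1) j.
exact: card_le_trans le_j (card_leT _).
Qed.

Theorem theorem3p1 (G : graph) (Gconn : connected G)
    (Gfin : locally_finite G) :
  exists G' : graph, subdivision G G' /\ localization_number_is G' 'I_1.
Proof.
have [[v0] _] := Gconn.
have [lev [lev_eq0 lev0 lev_adj lev_pred]] := level_exists v0 Gconn.
have [nb nbP] := neighbours_exist Gfin.
have [|u v uv|H [f [p sub]]] :=
    @subdivision_exists G (edge_length v0 nb lev).
- by move=> u v _; rewrite leq_max.
- exact: maxnC.
exists H; split; first by exists f, (edge_length v0 nb lev), p.
split; [by exists; exact: ord0 | | by move=> J J0 _; apply: card_I1_le].
exact: (subdivision_cops_win nbP lev_eq0 lev0 lev_adj lev_pred sub Gconn).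
Qed.
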